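(* Let $\mathcal{G}=(\mathcal{V},\mathcal{E},\sigma)$ be a signed graph with adjacency matrix $A$ and consider the opinion dynamics $$\dot{\mathbf{x}}=-d\,\mathbf{x}+U\,S(\alpha\mathbf{x}+\gamma A\mathbf{x}),\qquad \mathbf{x}\in\mathbb{R}^N.$$ This system is type $\mathcal{K}$ monotone (for some orthant $\mathcal{K}$ of $\mathbb{R}^N$) if and only if $\mathcal{G}$ is structurally balanced, i.e. $\mathcal{G}$ is switching equivalent to the graph $\mathcal{G}^+$ with the same vertices and edges for which the signature equals $1$ on every edge $e_{ik}\in\mathcal{E}$.
   Context: A signed graph $\mathcal{G}=(\mathcal{V},\mathcal{E},\sigma)$ has vertex set $\mathcal{V}=\{1,\dots,N\}$, directed edge set $\mathcal{E}$ ($e_{ik}$ points from $i$ to $k$), and signature $\sigma:\mathcal{E}\to\{1,-1\}$; the underlying directed graph is simple (no self-loops, at most one edge from $i$ to $k$). The signed adjacency matrix $A=(a_{ik})$ has $a_{ik}=\sigma(e_{ik})$ if $e_{ik}\in\mathcal{E}$ and $a_{ik}=0$ otherwise. For $\mathcal{W}\subset\mathcal{V}$, the switching function is $\theta:\mathcal{V}\to\{1,-1\}$ with $\theta(i)=-1$ if $i\in\mathcal{W}$ and $\theta(i)=1$ otherwise. Switching $\mathcal{W}$ on $\mathcal{G}$ produces $\mathcal{G}^{\mathcal{W}}=(\mathcal{V},\mathcal{E},\sigma_{\mathcal{W}})$ with $\sigma_{\mathcal{W}}(e_{ik})=\theta(i)\sigma(e_{ik})\theta(k)$. Two graphs are switching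 equivalent if one can be transformed into the other by switching some set of vertices. An orthant is a set $\mathcal{K}=\{\mathbf{x}\in\mathbb{R}^N:\ (-1)^{m_i}x_i\ge0,\ i=1,\dots,N\}$ with each $m_i\in\{0,1\}$. It generates the partial order $\mathbf{y}\le_{\mathcal{K}}\mathbf{x}$ iff $\mathbf{x}-\mathbf{y}\in\mathcal{K}$. A system $\dot{\mathbf{x}}=f(\mathbf{x})$ is type $\mathcal{K}$ monotone if its flow preserves $\le_{\mathcal{K}}$: $\mathbf{x}_1(0)\le_{\mathcal{K}}\mathbf{x}_2(0)$ implies $\mathbf{x}_1(t)\le_{\mathcal{K}}\mathbf{x}_2(t)$ for all $t>0$. In the dynamics, $d>0$, $\alpha\ge0$, $\gamma>0$, $U=\operatorname{diag}(u_1,\dots,u_N)$ with $u_i>0$; $S(\mathbf{y}):=(S(y_1),\dots,S(y_N))$ where $S:\mathbb{R}\to\mathbb{R}$ is a smooth, odd, saturating (bounded) function with $S(0)=0$, $S'(0)=1$, $\operatorname{sign}(S''(x))=-\operatorname{sign}(x)$. *)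

(* Defs.v *)
From mathcomp Require Import all_boot all_order all_algebra.
From mathcomp Require Import all_classical all_reals all_analysis.

Set Implicit Arguments.
Unset Strict Implicit.
Unset Printing Implicit Defensive.

Import Order.TTheory GRing.Theory Num.Theory.
Import numFieldNormedType.Exports.

Local Open Scope classical_set_scope.
Local Open Scope ring_scope.

(* [edge i k] means that there is an edge from i to k. The signature is a total
   function, but only its values on edges are meaningful; see [same_graph]. *)
Record signed_graph (N : nat) := SignedGraph {
  edge : rel 'I_N;
  sign : 'I_N -> 'I_N -> int;
  edge_irr : irreflexive edge;
  sign_edge : forall i k, edge i k -> sign i k = 1 \/ sign i k = -1
}.

Definition adjacency (R : realType) (N : nat) (G : signed_graph N) : 'M[R]_N :=
  \matrix_(i, k) if edge G i k then (sign G i k)%:~R else 0.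

Definition same_graph (N : nat) (G H : signed_graph N) : Prop :=
  (forall i k, edge G i k = edge H i k) /\
  (forall i k, edge G i k -> sign G i k = sign H i k).

Definition theta (N : nat) (W : {set 'I_N}) (i : 'I_N) : int :=
  if i \in W then -1 else 1.

Definition switched_sign (N : nat) (W : {set 'I_N}) (G : signed_graph N)
    (i k : 'I_N) : int :=
  theta W i * sign G i k * theta W k.

Lemma switched_sign_edge (N : nat) (W : {set 'I_N}) (G : signed_graph N) i k :
  edge G i k -> switched_sign W G i k = 1 \/ switched_sign W G i k = -1.
Proof.
move=> /sign_edge; rewrite /switched_sign /theta.
by case: (i \in W); case: (k \in W) => -[] ->; by [left|right].
Qed.

Definition switch (N : nat) (W : {set 'I_N}) (G : signed_graph N) :
    signed_graph N :=
  SignedGraph (@edge_irr N G) (@switched_sign_edge N W G).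

Definition switching_equivalent (N : nat) (G H : signed_graph N) : Prop :=
  exists W : {set 'I_N}, same_graph (switch W G) H.

Definition positive_graph (N : nat) (G : signed_graph N) : signed_graph N :=
  @SignedGraph N (edge G) (fun _ _ => 1) (@edge_irr N G)
    (fun _ _ _ => or_introl erefl).

Definition structurally_balanced (N : nat) (G : signed_graph N) : Prop :=
  switching_equivalent G (positive_graph G).

Definition orthant (R : realType) (N : nat) (m : 'I_N -> bool) :
    set 'cV[R]_N :=
  [set x | forall i, 0 <= (-1) ^+ m i * x i 0].

Definition is_orthant (R : realType) (N : nat) (K : set 'cV[R]_N) : Prop :=
  exists m : 'I_N -> bool, K = orthant m.

Definition cone_le (R : realType) (N : nat) (K : set 'cV[R]_N)
    (y x : 'cV[R]_N) : Prop :=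
  K (x - y).

(* x solves x' = f(x) on [0, T]; for continuous f, the one-sided differential
   equation at the endpoints follows from continuity there. *)
Definition solution (R : realType) (N : nat) (f : 'cV[R]_N -> 'cV[R]_N)
    (T : R) (x : R -> 'cV[R]_N) : Prop :=
  {within `[0, T], continuous x} /\
  (forall t, 0 < t < T -> is_derive t (1 : R) x (f (x t))).

(* The flow is expressed through its trajectories: the order is preserved at
   every t > 0 up to which both solutions exist, so global existence of
   solutions is not presupposed. *)
Definition type_K_monotone (R : realType) (N : nat) (K : set 'cV[R]_N)
    (f : 'cV[R]_N -> 'cV[R]_N) : Prop :=
  forall (x1 x2 : R -> 'cV[R]_N) (t : R), 0 < t ->
    solution f t x1 -> solution f t x2 ->
    cone_le K (x1 0) (x2 0) -> cone_le K (x1 t) (x2 t).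

Record saturating (R : realType) (S : R -> R) : Prop := Saturating {
  saturating_smooth : forall (n : nat) (y : R), derivable (derive1n n S) y 1;
  saturating_odd : forall y, S (- y) = - S y;
  saturating_bounded : bounded_fun S;
  saturating_0 : S 0 = 0;
  saturating_slope : derive1 S 0 = 1;
  saturating_sign : forall y, Num.sg (derive1n 2 S y) = - Num.sg y
}.

Definition opinion_field (R : realType) (N : nat) (A : 'M[R]_N)
    (d alpha gamma : R) (u : 'rV[R]_N) (S : R -> R) (x : 'cV[R]_N) : 'cV[R]_N :=
  - d *: x + diag_mx u *m map_mx S (alpha *: x + gamma *: (A *m x)).

(* Main.v *)
Require Import Defs.
From mathcomp Require Import all_boot all_order all_algebra.
From mathcomp Require Import all_classical all_reals all_analysis.
From mathcomp Require Import ring lra.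
Import Order.TTheory GRing.Theory Num.Theory.
Import numFieldNormedType.Exports.
Local Open Scope classical_set_scope.
Local Open Scope ring_scope.

(** Let theta be the vector of signs of an orthant. Both implications go through
    the same condition on the adjacency matrix: the system is monotone for the
    orthant if and only if 0 <= theta_i a_ik theta_k for all i != k. As the
    entries of A on the edges are signs, this says that switching the vertices i
    with theta_i = -1 makes all the edges positive.

    The function S is increasing and 1-Lipschitz: its slope is even, and
    strictly decreasing on the nonnegative half-line, where it cannot reach a
    negative value since S is bounded.

    Sufficiency ([opinion_field_monotone]). For two solutions x1, x2 put
    z = theta (x2 - x1). Since S is odd, increasing and 1-Lipschitz, z satisfies
    a differential inequality z_i' >= C v - d z_i for every lower bound v <= 0 of
    all the coordinates z_k. A minimum argument applied to exp(-K t) z(t), with K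
    large, shows that z stays nonnegative ([nonneg_of_quasipositive]).

    Necessity ([monotone_adjacency]). If theta_i a_ik theta_k < 0, compare the
    zero solution with the one that starts at theta_k e_k, which is larger for
    the order of the orthant. The i-th coordinate of the latter, multiplied by
    theta_i, vanishes at time 0 and has there the derivative
    u_i S(gamma theta_i a_ik theta_k) < 0, so that the order is lost at once.
    That solution has to be constructed: the vector field is globally Lipschitz
    and [lipschitz_ode_local_solution] gives it by Picard iteration. *)

(** * Saturating functions *)

Section saturating_function.
Context (R : realType) (S : R -> R).
Hypothesis hS : saturating S.

Lemma saturating_is_derive (n : nat) (y : R) :
  is_derive y 1 (derive1n n S) (derive1n n.+1 S y).
Proof.
by apply: DeriveDef; [exact: saturating_smooth|rewrite /derive1n iterS derive1E].
Qed.

Lemma saturating_MVT (n : nat) (a b : R) : a < b ->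
  exists2 c, a < c < b & derive1n n S b - derive1n n S a =
    derive1n n.+1 S c * (b - a).
Proof.
move=> ab.
have [||c] := @MVT R (derive1n n S) (derive1n n.+1 S) a b ab.
- by move=> x _; exact: saturating_is_derive.
- apply: derivable_within_continuous => x _.
  exact: saturating_smooth.
- by rewrite in_itv /= => cab ->; exists c.
Qed.

Lemma saturating_slope_even (y : R) : derive1n 1 S (- y) = derive1n 1 S y.
Proof.
have dS (x : R) : is_derive x (1 : R) S (derive1n 1 S x) by
  exact: (saturating_is_derive 0).
have e : (fun x => S (- x)) = (fun x => - S x).
  by apply/funext => x; exact: saturating_odd.
have d1 : is_derive y 1 (fun x => S (- x)) (derive1n 1 S (- y) * -1).
  by apply: (@is_derive1_comp R S (@GRing.opp R)).
have d2 : is_derive y 1 (fun x => - S x) (- derive1n 1 S y).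
  by apply: (is_deriveN (f := S)).
have : 'D_1 (fun x => S (- x)) y = 'D_1 (fun x => - S x) y by rewrite e.
by rewrite !derive_val mulrN1 => /oppr_inj.
Qed.

Lemma saturating_slope_decr (x y : R) :
  0 <= x -> x < y -> derive1n 1 S y < derive1n 1 S x.
Proof.
move=> x0 xy; have [c /andP[xc cy] e] := saturating_MVT 1 _ _ xy.
have c0 : 0 < c by exact: le_lt_trans xc.
have : derive1n 2 S c < 0.
  by rewrite -sgr_lt0 (saturating_sign hS) gtr0_sg// ltrN10.
by move=> h; rewrite -subr_lt0 e nmulr_rlt0// subr_gt0.
Qed.

Lemma saturating_slope_gt0 (y : R) : 0 < derive1n 1 S y.
Proof.
wlog y0 : y / 0 <= y.
  move=> h; have [/h//|/ltW y0] := leP 0 y.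
  by rewrite -saturating_slope_even; apply: h; rewrite oppr_ge0.
suff h x : 0 < x -> 0 <= derive1n 1 S x.
  apply: le_lt_trans (saturating_slope_decr y (y + 1) y0 _).
    by apply: h; lra.
  lra.
move=> x0; rewrite leNgt; apply/negP => slx.
have [M [Mreal hM]] := saturating_bounded hS.
have {}hM z : `|S z| <= `|M| + 1.
  by apply: hM => //; rewrite (le_lt_trans (ler_norm M))// ltrDl.
set K := `|M| + 1 in hM.
have K0 : 0 < K by rewrite /K ltr_wpDl.
set s := derive1n 1 S x in slx.
(* If the slope at x were s < 0, S would decrease by at least 3 K, more than the
   2 K that its bound K allows, between x and x - 3 K / s. *)
have step : 0 < (3 * K) / - s by rewrite divr_gt0// ?oppr_gt0//; lra.
have xy : x < x + (3 * K) / - s by rewrite ltrDl.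
have [c /andP[xc cy] /= e] := saturating_MVT 0 _ _ xy.
have : derive1n 1 S c * (x + 3 * K / - s - x) <= - (3 * K).
  have sc : derive1n 1 S c < s by apply: saturating_slope_decr => //; exact: ltW.
  rewrite addrAC subrr add0r.
  have -> : - (3 * K) = s * (3 * K / - s) by field; lra.
  by rewrite ler_pM2r// ltW.
rewrite -e.
have := hM x; have := hM (x + 3 * K / - s).
by rewrite !ler_norml => /andP[? ?] /andP[? ?]; lra.
Qed.

Lemma saturating_slope_le1 (y : R) : derive1n 1 S y <= 1.
Proof.
wlog y0 : y / 0 <= y.
  move=> h; have [/h//|/ltW y0] := leP 0 y.
  by rewrite -saturating_slope_even; apply: h; rewrite oppr_ge0.
rewrite -(saturating_slope hS); move: y0; rewrite le_eqVlt => /predU1P[<-//|y0].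
by apply/ltW; apply: saturating_slope_decr.
Qed.

Lemma saturating_increasing (a b : R) : a < b -> S a < S b.
Proof.
move=> ab; have [c _ /= e] := saturating_MVT 0 _ _ ab.
by rewrite -subr_gt0 e mulr_gt0 ?saturating_slope_gt0 ?subr_gt0.
Qed.

Lemma saturating_gt0 (a : R) : 0 < a -> 0 < S a.
Proof. by move=> /saturating_increasing; rewrite (saturating_0 hS). Qed.

Lemma saturating_nondecreasing (a b : R) : a <= b -> S a <= S b.
Proof.
by rewrite le_eqVlt => /predU1P[->//|/saturating_increasing /ltW].
Qed.

Lemma saturating_lipschitz (a b : R) : `|S b - S a| <= `|b - a|.
Proof.
wlog ab : a b / a < b.
  by move=> h; have [/h//|/h|->] := ltgtP a b;
    [rewrite distrC (distrC b)|rewrite !subrr].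
have [c _ /= e] := saturating_MVT 0 _ _ ab.
rewrite [S b - S a]e normrM ler_piMl// gtr0_norm ?saturating_slope_gt0//.
exact: saturating_slope_le1.
Qed.

(** Lower bound on an increment of S that does not know the sign of b - a. *)
Lemma saturating_incr_ge (a b v : R) : v <= 0 -> v <= b - a -> v <= S b - S a.
Proof.
move=> v0 vab; have [ab|/ltW ba] := leP a b.
  by rewrite (le_trans v0)// subr_ge0 saturating_nondecreasing.
have := saturating_lipschitz a b.
rewrite ler0_norm ?subr_le0 ?saturating_nondecreasing// ler0_norm ?subr_le0//.
by rewrite lerN2; apply: le_trans.
Qed.

End saturating_function.

(** * Differential inequalities *)

Section nonnegativity.
Context (R : realType) (m : nat) (z dz : 'I_m -> R -> R) (T d C : R).
Hypotheses (T0 : 0 < T) (d0 : 0 <= d) (C0 : 0 <= C).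
Hypothesis cz : forall i, {within `[0, T], continuous (z i)}.
Hypothesis z_dz : forall i t, 0 < t < T -> is_derive t (1 : R) (z i) (dz i t).
Hypothesis dz_ge : forall i t v, 0 < t < T -> v <= 0 ->
  (forall k, v <= z k t) -> C * v - d * z i t <= dz i t.
Hypothesis z_init : forall i, 0 <= z i 0.

(** Positive invariance of the nonnegative orthant: [dz_ge] says that z_i' is
    almost nonnegative when z_i is close to 0 and the other coordinates are
    almost nonnegative.

    If the minimum mu of all the w j t = exp(- K t) z j t were negative, it would
    be attained at some w j and t0 > 0. Where w j is close to mu, its derivative
    is at least C mu - (d + K) w j > 0, and w j would increase up to t0. *)
Lemma nonneg_of_quasipositive i : 0 <= z i T.
Proof.
rewrite leNgt; apply/negP => ziT.
(* With this rate, K (mu / 2) < C mu for every mu < 0. *)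
pose K := 2 * C + 1; pose w j t := expR (- K * t) * z j t.
have K0 : 0 < K by rewrite ltr_wpDl// mulr_ge0.
have dw j t : 0 < t < T ->
    is_derive t (1 : R) (w j) (expR (- K * t) * (dz j t - K * z j t)).
  move=> tT; have dzj := z_dz j t tT.
  have dE : is_derive t (1 : R) (fun t => expR (- K * t)) (expR (- K * t) * - K).
    apply: (@is_derive1_comp R expR (fun t => - K * t)).
    have := is_deriveM (is_derive_cst (- K) t 1) (is_derive_id t (1 : R)).
    by rewrite scaler0 addr0 [_ *: _]mulr1; apply.
  have := is_deriveM dE dzj; move=> /(@is_derive_eq _ _ _ (w j)); apply.
  rewrite /GRing.scale /=; ring.
have cw j : {within `[0, T], continuous (w j)}.
  move=> t; apply: cvgM; last exact: cz.
  apply: continuous_subspaceT => {}t.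
  apply: (@continuous_comp _ _ _ (fun t => - K * t) expR); last exact: continuous_expR.
  by apply: cvgM; [exact: cvg_cst|exact: cvg_id].
have /choice [c cP] j : exists c, c \in `[0, T] /\
    forall t, t \in `[0, T] -> w j c <= w j t.
  by have [c ? ?] := EVT_min (ltW T0) (cw j); exists c.
have [j _ jmin] := @Order.TotalTheory.arg_minP _ _ _ i xpredT (fun j => w j (c j)) isT.
pose mu := w j (c j).
have mu_le k t : t \in `[0, T] -> mu <= w k t.
  by move=> tT; apply: le_trans (jmin k isT) _; have [_] := cP k; apply.
have mu0 : mu < 0.
  apply: (@le_lt_trans _ _ (w i T)); last by rewrite pmulr_rlt0// expR_gt0.
  by apply: mu_le; rewrite in_itv /= lexx ltW.
have [+ _] := cP j; rewrite in_itv /= => /andP[t0_ge t0_le].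
set t0 := c j in mu mu_le mu0 t0_ge t0_le.
have t0_gt0 : 0 < t0.
  rewrite lt_neqAle t0_ge andbT; apply/eqP => t00.
  by move: mu0; rewrite /mu -t00 /w mulr0 expR0 mul1r ltNge z_init.
(* Just before t0 the coordinate w j is still below mu / 2, which makes its
   derivative positive, although it reaches its minimum at t0. *)
have [e e0 near_t0] : exists2 e, 0 < e & forall r,
    `|t0 - r| < e -> r \in `[0, T] -> w j r < mu / 2.
  have /subspace_continuousP/(_ t0) := cw j.
  rewrite /= in_itv /= t0_ge t0_le => /(_ isT) /cvgrPdist_lt/(_ (- mu / 2)).
  rewrite divr_gt0 ?oppr_gt0// => /(_ isT)/nbhs_ballP[e /= e0 h].
  exists e => // r re rT.
  have : `|mu - w j r| < - mu / 2 by apply: h => //; rewrite -ball_normE.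
  by rewrite ltr_norml => /andP[? ?]; lra.
pose s := Num.max 0 (t0 - e / 2).
have s0 : 0 <= s by rewrite /s le_max lexx.
have st0 : s < t0 by rewrite /s gt_max t0_gt0 /= ltrBlDr ltrDl divr_gt0.
have se : t0 - e / 2 <= s by rewrite /s le_max lexx orbT.
have dws r : r \in `]s, t0[ ->
    is_derive r (1 : R) (w j) (expR (- K * r) * (dz j r - K * z j r)).
  rewrite in_itv /= => /andP[sr rt0].
  by apply: dw; rewrite (le_lt_trans s0 sr) (lt_le_trans rt0 t0_le).
have cws : {within `[s, t0], continuous (w j)}.
  apply: continuous_subspaceW (cw j).
  by apply: subset_itv; rewrite ?bnd_simp.
have [r] := MVT st0 dws cws.
rewrite in_itv /= => /andP[sr rt0].
have r0T : 0 < r < T by rewrite (le_lt_trans s0 sr) (lt_le_trans rt0 t0_le).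
have rT : r \in `[0, T] by rewrite in_itv /= !ltW//; have /andP[] := r0T.
have sT : s \in `[0, T] by rewrite in_itv /= s0 /= (le_trans (ltW st0) t0_le).
have wr : w j r < mu / 2.
  by apply: near_t0 => //; rewrite ger0_norm ?subr_ge0 ?ltW//; lra.
have E0 : 0 < expR (- K * r) by exact: expR_gt0.
have EE : expR (- K * r) * expR (K * r) = 1.
  by rewrite -expRD mulNr addNr expR0.
have v0 : expR (K * r) * mu <= 0 by rewrite pmulr_rle0 ?expR_gt0// ltW.
have := dz_ge j r (expR (K * r) * mu) r0T v0.
have vz k : expR (K * r) * mu <= z k r.
  by rewrite -(ler_pM2l E0) mulrA EE mul1r; exact: mu_le.
move=> /(_ vz) dz_r e_mvt.
have : 0 < expR (- K * r) * (dz j r - K * z j r).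
  have : expR (- K * r) * (C * (expR (K * r) * mu) - d * z j r) <=
      expR (- K * r) * dz j r by rewrite ler_pM2l.
  have -> : expR (- K * r) * (C * (expR (K * r) * mu) - d * z j r) =
      C * mu * (expR (- K * r) * expR (K * r)) - d * w j r by rewrite /w; ring.
  rewrite EE mulr1 mulrBr.
  have -> : expR (- K * r) * (K * z j r) = K * w j r by rewrite /w; ring.
  have dwr : d * w j r <= 0.
    by rewrite mulr_ge0_le0// (le_trans (ltW wr))//; lra.
  have Kw : K * w j r < K * (mu / 2) by rewrite ltr_pM2l.
  by move: Kw; rewrite {2}/K; lra.
have : w j t0 - w j s <= 0 by rewrite subr_le0; exact: mu_le.
rewrite e_mvt => h1 h2; move: h1; rewrite leNgt mulr_gt0//.
by rewrite subr_gt0.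
Qed.

End nonnegativity.

(** * Antiderivatives and geometric convergence *)

Section sup_norm.
Context (R : realType) (m : nat).
Implicit Types x : 'cV[R]_m.

Lemma ler_cV_norm x i : `|x i 0| <= `|x|.
Proof.
rewrite [leRHS]/Num.Def.normr/= mx_normrE.
exact: (le_bigmax _ (fun ij => `|x ij.1 ij.2|) (i, 0)).
Qed.

Lemma cV_norm_le x e : 0 <= e -> (forall i, `|x i 0| <= e) -> `|x| <= e.
Proof.
move=> e0 h; rewrite [leLHS]/Num.Def.normr/= mx_normrE.
by apply: bigmax_le => // -[i j] _ /=; rewrite (ord1 j).
Qed.

End sup_norm.

Lemma div_expn2_small (R : realType) (D e : R) : 0 < e ->
  exists n, D / 2 ^+ n < e.
Proof.
move=> e0.
have small : D / 2 ^+ n @[n --> \oo] --> 0.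
  have := @cvg_geometric R D 2^-1.
  rewrite ger0_norm ?invr_ge0// invf_lt1// ltr1n => /(_ isT).
  by rewrite /geometric /=; under eq_fun do rewrite exprVn.
by have [n _ /(_ n (leqnn n)) sn] := cvgr_lt _ small _ e0; exists n.
Qed.

Lemma half_cauchy_cvg (R : realType) (u : R ^nat) (D : R) :
  (forall n, `|u n.+1 - u n| <= D / 2 ^+ n) ->
  cvgn u /\ forall n, `|limn u - u n| <= 2 * D / 2 ^+ n.
Proof.
move=> uD.
have D0 : 0 <= D by have := uD 0; rewrite expr0 divr1; apply: le_trans.
have dist n k : `|u (n + k)%N - u n| <= 2 * D / 2 ^+ n.
  elim: k n => [|k ih] n.
    by rewrite addn0 subrr normr0 divr_ge0 ?mulr_ge0 ?exprn_ge0.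
  rewrite addnS -addSn -(subrKA (u n.+1)).
  rewrite (le_trans (ler_normD _ _))// (le_trans (lerD (ih _) (uD n)))//.
  rewrite exprS invfM mulrACA mulfV// mul1r -mulrDl ler_wpM2r//.
  lra.
have cu : cvgn u.
  apply/cauchy_cvgP/cauchy_exP => e e0.
  have [n sn] := div_expn2_small R (2 * D) e e0.
  exists (u n); exists n => // k /= nk.
  rewrite -ball_normE /= distrC -(subnKC nk).
  by rewrite (le_lt_trans (dist _ _)).
split=> // n.
have cn : `|u k - u n| @[k --> \oo] --> `|limn u - u n|.
  by apply: cvg_norm; apply: cvgB => //; exact: cvg_cst.
rewrite -(cvg_lim _ cn)//; apply: limr_le; first by apply/cvg_ex; eexists; exact: cn.
by exists n => // k /= nk; rewrite -(subnKC nk).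
Qed.

(** The antiderivative of g that vanishes at 0. Integrating from -1 makes it
    differentiable at 0 too, without one-sided derivatives. *)
Definition primitive {R : realType} (g : R -> R) (t : R) : R :=
  \int[lebesgue_measure]_(s in `[-1, t]) g s -
  \int[lebesgue_measure]_(s in `[-1, 0]) g s.

Section primitive_theory.
Context (R : realType).
Implicit Types (g h : R -> R) (t D : R).

Lemma primitive0 g : primitive g 0 = 0.
Proof. exact: subrr. Qed.

Lemma is_derive_primitive g t : continuous g -> -1 < t ->
  is_derive t (1 : R) (primitive g) (g t).
Proof.
move=> cg t1.
have [||dF F't] := @continuous_FTC1_closed R g (-1) t (t + 1) _ _ t1 (cg t).
- by rewrite ltrDl.
- apply: continuous_compact_integrable; first exact: segment_compact.
  exact: continuous_subspaceT.
rewrite -[g t]subr0; apply: is_deriveB.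
by rewrite -F't derive1E; exact/derivableP.
Qed.

Lemma primitive_dist g h t D : continuous g -> continuous h ->
  (forall s, `|g s - h s| <= D) -> 0 <= t ->
  `|primitive g t - primitive h t| <= D * t.
Proof.
move=> cg ch D_gh; rewrite le_eqVlt => /predU1P[<-|t0].
  by rewrite !primitive0 subrr normr0 mulr0.
have d s : s \in `[0, t] ->
    is_derive s (1 : R) (primitive g - primitive h) (g s - h s).
  rewrite in_itv /= => /andP[s0 _].
  by apply: is_deriveB; apply: is_derive_primitive => //; lra.
have cF : {within `[0, t], continuous (primitive g - primitive h)}.
  by apply: derivable_within_continuous => s /d [].
have d' s : s \in `]0, t[ ->
    is_derive s (1 : R) (primitive g - primitive h) (g s - h s).
  by move=> st; apply: d; exact: subset_itv_oo_cc.
have [c _] := MVT t0 d' cF.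
rewrite !fctE !primitive0 !subr0 => ->.
by rewrite normrM (gtr0_norm t0) ler_wpM2r// ltW.
Qed.

Lemma primitive_cst0 t : primitive (cst 0) t = 0.
Proof. by rewrite /primitive !Rintegral_cst// !mul0r subrr. Qed.

End primitive_theory.

(** * Local solutions of Lipschitz differential equations *)

Section lipschitz_ode.
Context (R : realType) (m : nat) (f : 'cV[R]_m -> 'cV[R]_m) (L : R).
Hypothesis f_lip : forall x y, `|f x - f y| <= L * `|x - y|.

Lemma lipschitz_continuous : continuous f.
Proof.
move=> x; apply/(@cvgrPdist_lt _ _ _ (nbhs x)) => e e0.
have K0 : 0 < `|L| + 1 by rewrite ltr_wpDl.
near=> y; rewrite (le_lt_trans (f_lip _ _))//.
rewrite (@le_lt_trans _ _ ((`|L| + 1) * `|x - y|))//.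
  by rewrite ler_wpM2r// (le_trans (ler_norm L))// lerDl.
rewrite mulrC -ltr_pdivlMr//; near: y.
apply/nbhs_ballP; exists (e / (`|L| + 1)); first exact: divr_gt0.
by move=> y; rewrite -ball_normE.
Unshelve. all: by end_near. Qed.

(** Projection of the real line onto [0, T]. *)
Definition clamp (T t : R) : R := Num.max 0 (Num.min T t).

Lemma clamp_continuous (T : R) : continuous (clamp T).
Proof.
move=> t; apply: (@continuous_max R _ (cst 0) (fun t => Num.min T t) t).
  exact: cvg_cst.
by apply: (@continuous_min R _ (cst T) id t); [exact: cvg_cst|exact: cvg_id].
Qed.

Lemma clampE (T t : R) : 0 <= t <= T -> clamp T t = t.
Proof.
by move=> /andP[t0 tT]; rewrite /clamp (min_idPr tT) (max_idPr t0).
Qed.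

Lemma clamp_itv (T t : R) : 0 <= T -> 0 <= clamp T t <= T.
Proof. by move=> T0; rewrite /clamp le_max lexx ge_max T0 ge_min lexx. Qed.

(** The Picard operator of x' = f x, x 0 = x0 on [0, T]; freezing the time
    outside [0, T] makes it act on functions continuous on the whole line. *)
Definition picard (T : R) (x0 : 'cV[R]_m) (y : R -> 'cV[R]_m) (t : R) :
    'cV[R]_m :=
  x0 + \col_i primitive (fun s => f (y s) i 0) (clamp T t).

Section picard_theory.
Context (T : R) (x0 : 'cV[R]_m).
Hypothesis T0 : 0 <= T.
Implicit Types y z : R -> 'cV[R]_m.

Lemma coord_field_continuous y i :
  continuous y -> continuous (fun s => f (y s) i 0).
Proof.
move=> cy s.
apply: (@continuous_comp _ _ _ (f \o y) (fun M : 'cV[R]_m => M i 0) s).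
  by apply: continuous_comp; [exact: cy|exact: lipschitz_continuous].
exact: coord_continuous.
Qed.

Lemma cV_continuous y : (forall i, continuous (fun s => y s i 0)) -> continuous y.
Proof.
move=> cy s; apply/cvgrPdist_le => e e0.
near=> r; apply: cV_norm_le => [|i]; first exact: ltW.
rewrite !mxE; move: i; near: r; apply: filter_forall => i.
by have /cvgrPdist_le/(_ _ e0) := cy i s.
Unshelve. all: by end_near. Qed.

Lemma picard_continuous y : continuous y -> continuous (picard T x0 y).
Proof.
move=> cy; apply: cV_continuous => i.
have -> : (fun s => picard T x0 y s i 0) =
    (fun s => x0 i 0 + (primitive (fun s => f (y s) i 0) \o clamp T) s).
  by apply/funext => s; rewrite !mxE.
move=> s; apply: cvgD; first exact: cvg_cst.
apply: continuous_comp; first exact: clamp_continuous.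
apply/differentiable_continuous/derivable1_diffP.
have [c0 _] := andP (clamp_itv T s T0).
have [] // := is_derive_primitive _ _ (clamp T s) (coord_field_continuous y i cy) _.
lra.
Qed.

Lemma picard_dist y z D : continuous y -> continuous z ->
  (forall s, `|f (y s) - f (z s)| <= D) ->
  forall t, `|picard T x0 y t - picard T x0 z t| <= D * T.
Proof.
move=> cy cz yzD t.
have D0 : 0 <= D by apply: le_trans (yzD 0).
have [c0 cT] := andP (clamp_itv T t T0).
apply: cV_norm_le => [|i]; first exact: mulr_ge0.
rewrite !mxE opprD addrACA subrr add0r.
apply: (@le_trans _ _ (D * clamp T t)); last exact: ler_wpM2l.
apply: primitive_dist => //; [exact: coord_field_continuous..|].
move=> s; apply: le_trans (yzD s).
by have := ler_cV_norm _ _ (f (y s) - f (z s)) i; rewrite !mxE.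
Qed.

Lemma picard_fixed_solution y : continuous y ->
  (forall t, y t = picard T x0 y t) -> y 0 = x0 /\ solution f T y.
Proof.
move=> cy yE; split; [|split].
- rewrite yE; apply/colP => i.
  by rewrite !mxE clampE ?lexx//= primitive0 addr0.
- exact: continuous_subspaceT.
move=> t tT.
have [t0 _] := andP tT.
have dy i : is_derive t (1 : R) (fun s => y s i 0) (f (y t) i 0).
  have d : is_derive t (1 : R)
      (fun s => x0 i 0 + primitive (fun s => f (y s) i 0) s) (0 + f (y t) i 0).
    apply: is_deriveD; apply: is_derive_primitive; last lra.
    exact: coord_field_continuous.
  rewrite add0r in d; apply: near_eq_is_derive d.
  near=> s; rewrite [in RHS]yE !mxE clampE//; apply/andP.
  have : s \in `]0, T[ by near: s; apply: near_in_itvoo; rewrite in_itv.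
  by rewrite in_itv /= => /andP[/ltW ? /ltW ?].
have y1 : derivable y t 1.
  by apply/derivable_mxP => i j; rewrite (ord1 j); have [] := dy i.
apply: DeriveDef => //; rewrite derive_mx//; apply/colP => i; rewrite mxE.
by have [] := dy i.
Unshelve. all: by end_near. Qed.

End picard_theory.
(** Picard-Lindelof, local existence. *)
Theorem lipschitz_ode_local_solution (x0 : 'cV[R]_m) :
  exists T x, [/\ 0 < T, x 0 = x0 & solution f T x].
Proof.
have K0 : 0 < `|L| + 1 by rewrite ltr_wpDl.
(* This length makes the Picard operator 1/2-contracting. *)
pose T : R := (2 * (`|L| + 1))^-1.
have T0 : 0 < T by rewrite invr_gt0 mulr_gt0.
have LT : `|L| * T <= 2^-1.
  by rewrite /T invfM mulrCA ler_piMr ?invr_ge0// ler_pdivrMr// mul1r lerDl.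
have f_lip' y z E : `|y - z| <= E -> `|f y - f z| <= `|L| * E.
  move=> yzE; rewrite (le_trans (f_lip y z))//.
  by rewrite (le_trans (ler_wpM2r _ (ler_norm L)))// ler_wpM2l.
pose P := picard T x0; pose u n := iter n P (cst x0).
have cu n : continuous (u n).
  elim: n => [|n ih]; first by move=> t; exact: cvg_cst.
  by apply: picard_continuous => //; exact: ltW.
pose D := `|f x0| * T.
have D0 : 0 <= D by rewrite mulr_ge0// ltW.
have P_dist y z E : continuous y -> continuous z ->
    (forall t, `|y t - z t| <= E) -> forall t, `|P y t - P z t| <= E / 2.
  move=> cy cz yzE t.
  have E0 : 0 <= E by apply: le_trans (yzE 0).
  apply: (@le_trans _ _ (`|L| * E * T)).
    by apply: picard_dist => // [|s]; [exact: ltW|exact: f_lip'].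
  by rewrite mulrAC mulrC ler_wpM2l.
have step n t : `|u n.+1 t - u n t| <= D / 2 ^+ n.
  elim: n t => [|n ih] t; last first.
    rewrite exprSr invfM mulrA.
    by apply: (P_dist (u n.+1) (u n)).
  have [c0 cT] := andP (clamp_itv T t (ltW T0)).
  rewrite expr0 divr1; apply: cV_norm_le => // i.
  rewrite /u /= /P /picard addrC addKr mxE.
  rewrite -[X in `|X|]subr0 -(primitive_cst0 R (clamp T t)).
  apply: (@le_trans _ _ (`|f x0| * clamp T t)); last exact: ler_wpM2l.
  apply: primitive_dist => //; first exact: (coord_field_continuous _ i (cu 0)).
    by move=> s; exact: cvg_cst.
  by move=> s; rewrite subr0; exact: ler_cV_norm.
pose x t : 'cV[R]_m := \col_i limn (fun n => u n t i 0).
have x_dist n t : `|x t - u n t| <= 2 * D / 2 ^+ n.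
  apply: cV_norm_le => [|i]; first by rewrite divr_ge0// mulr_ge0.
  have [|_] := @half_cauchy_cvg R (fun n => u n t i 0) D.
    move=> k; apply: le_trans (step k t).
    by have := ler_cV_norm _ _ (u k.+1 t - u k t) i; rewrite !mxE.
  by move=> /(_ n); rewrite !mxE.
have cx : continuous x.
  apply: cV_continuous => i t; apply/cvgrPdist_le => e e0.
  have [n ne] := div_expn2_small R (2 * D) (e / 3) (divr_gt0 e0 (ltr0n _ 3)).
  have x_dist' s : `|x s i 0 - u n s i 0| <= e / 3.
    apply: le_trans (ltW ne); apply: le_trans (x_dist n s).
    by have := ler_cV_norm _ _ (x s - u n s) i; rewrite !mxE.
  near=> s.
  have uts : `|u n t i 0 - u n s i 0| <= e / 3.
    near: s; have cut : continuous (fun s => u n s i 0).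
      move=> s; apply: (@continuous_comp _ _ _ (u n) (fun M : 'cV[R]_m => M i 0)).
        exact: cu.
      exact: coord_continuous.
    have /cvgrPdist_le := cut t; apply; exact: divr_gt0.
  have := x_dist' t; have := x_dist' s; move: uts.
  rewrite !ler_norml => /andP[? ?] /andP[? ?] /andP[? ?].
  by apply/andP; split; lra.
have xP t : x t = P x t.
  apply/eqP; rewrite -subr_eq0 -normr_le0; apply/ler_addgt0Pl => e e0.
  have [n ne] := div_expn2_small R (2 * D) (e / 2) (divr_gt0 e0 (ltr0n _ 2)).
  rewrite addr0 -(subrKA (u n.+1 t)) (le_trans (ler_normD _ _))// (splitr e).
  have PE : `|P (u n) t - P x t| <= (e / 2) / 2.
    apply: P_dist => // s; rewrite distrC; apply: le_trans (ltW ne); exact: x_dist.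
  have xE : `|x t - u n.+1 t| <= (e / 2) / 2.
    rewrite (le_trans (x_dist _ _))// exprSr invfM mulrA ler_wpM2r//.
    exact: ltW.
  apply: lerD; first lra.
  by apply: le_trans PE _; lra.
have [] := picard_fixed_solution T x0 (ltW T0) x cx xP.
by exists T, x.
Unshelve. all: by end_near. Qed.

End lipschitz_ode.

(** * Monotonicity of the opinion dynamics *)

Section coordinates.
Context (R : realType) (m : nat).
Implicit Types x : R -> 'cV[R]_m.

Lemma within_continuous_coord x (D : set R) i :
  {within D, continuous x} -> {within D, continuous (fun t => x t i 0)}.
Proof.
move=> cx t.
apply: (@continuous_comp (subspace D) _ _ x (fun M : 'cV[R]_m => M i 0)).
  exact: cx.
exact: coord_continuous.
Qed.

Lemma is_derive_coord x t (dx : 'cV[R]_m) i :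
  is_derive t (1 : R) x dx -> is_derive t (1 : R) (fun s => x s i 0) (dx i 0).
Proof.
move=> [dvx <-]; have /derivable_mxP/(_ i 0) dvxi := dvx.
by apply: DeriveDef => //; rewrite derive_mx// mxE.
Qed.

Lemma solution_subitv (f : 'cV[R]_m -> 'cV[R]_m) (s T : R) x :
  s <= T -> solution f T x -> solution f s x.
Proof.
move=> sT [cx dx]; split.
  by apply: continuous_subspaceW cx; apply: subset_itv; rewrite ?bnd_simp.
by move=> t /andP[t0 ts]; apply: dx; rewrite t0 (lt_le_trans ts).
Qed.

End coordinates.

Section opinion.
Context (R : realType) (m : nat) (A : 'M[R]_m) (d alpha gamma : R).
Context (u : 'rV[R]_m) (S : R -> R).
Hypotheses (d0 : 0 < d) (alpha0 : 0 <= alpha) (gamma0 : 0 < gamma).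
Hypothesis u0 : forall i, 0 < u 0 i.
Hypothesis hS : saturating S.

Local Notation F := (opinion_field A d alpha gamma u S).

(** The argument of S in the equation of vertex i. *)
Definition input (x : 'cV[R]_m) (i : 'I_m) : R :=
  alpha * x i 0 + gamma * \sum_k A i k * x k 0.

Lemma opinion_fieldE x i : F x i 0 = - d * x i 0 + u 0 i * S (input x i).
Proof. by rewrite /opinion_field mul_diag_mx !mxE. Qed.

(** A Lipschitz constant common to all the inputs. *)
Definition input_gain : R := alpha + gamma * \sum_i \sum_k `|A i k|.

Lemma input_gain_ge0 : 0 <= input_gain.
Proof.
apply: addr_ge0 => //; apply: mulr_ge0; first exact: ltW.
by apply: sumr_ge0 => i _; apply: sumr_ge0.
Qed.

Lemma input_gain_ge i : alpha + gamma * \sum_k `|A i k| <= input_gain.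
Proof.
rewrite lerD2l ler_pM2l// [leRHS](bigD1 i)//= lerDl.
by apply: sumr_ge0 => j _; apply: sumr_ge0.
Qed.

Lemma sum_u_ge i : u 0 i <= \sum_j u 0 j.
Proof.
by rewrite [leRHS](bigD1 i)//= lerDl; apply: sumr_ge0 => j _; exact: ltW.
Qed.

Lemma input_dist x y i : `|input x i - input y i| <= input_gain * `|x - y|.
Proof.
have -> : input x i - input y i =
    alpha * (x - y) i 0 + gamma * \sum_k A i k * (x - y) k 0.
  rewrite /input opprD addrACA -!mulrBr -sumrB !mxE; congr (_ + _ * _).
  by apply: eq_bigr => k _; rewrite !mxE mulrBr.
apply: le_trans (ler_wpM2r (normr_ge0 _) (input_gain_ge i)).
rewrite (le_trans (ler_normD _ _))// mulrDl !normrM (ger0_norm alpha0).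
rewrite (gtr0_norm gamma0) lerD//; first by rewrite ler_wpM2l// ler_cV_norm.
rewrite -mulrA ler_pM2l// (le_trans (ler_norm_sum _ _ _))// mulr_suml.
by apply: ler_sum => k _; rewrite normrM ler_wpM2l// ler_cV_norm.
Qed.

Lemma opinion_field_lipschitz x y :
  `|F x - F y| <= (d + (\sum_j u 0 j) * input_gain) * `|x - y|.
Proof.
have U0 : 0 <= \sum_j u 0 j by apply: sumr_ge0 => j _; exact: ltW.
have G0 := input_gain_ge0.
apply: cV_norm_le => [|i].
  by rewrite mulr_ge0// addr_ge0 ?mulr_ge0// ltW.
have -> : (F x - F y) i 0 =
    - d * (x - y) i 0 + u 0 i * (S (input x i) - S (input y i)).
  by rewrite [LHS]mxE [(- F y) i 0]mxE !opinion_fieldE !mxE; ring.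
rewrite (le_trans (ler_normD _ _))// mulrDl !normrM normrN (gtr0_norm d0).
rewrite (gtr0_norm (u0 i)) lerD//; first by rewrite ler_pM2l// ler_cV_norm.
rewrite -mulrA; apply: ler_pM; [exact: ltW|by []|exact: sum_u_ge|].
by rewrite (le_trans (saturating_lipschitz _ _ hS _ _))// input_dist.
Qed.

Lemma saturating_signr (b : bool) y : (-1) ^+ b * S y = S ((-1) ^+ b * y).
Proof. by case: b; rewrite ?mul1r// !mulN1r (saturating_odd hS). Qed.

Lemma opinion_field_monotone (b : 'I_m -> bool) :
  (forall i k, 0 <= (-1) ^+ b i * A i k * (-1) ^+ b k) ->
  type_K_monotone (orthant b) F.
Proof.
move=> Ab x1 x2 T T0 [cx1 dx1] [cx2 dx2] x12 i.
pose z j t := (-1) ^+ b j * (x2 t j 0 - x1 t j 0).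
pose dz j t := (-1) ^+ b j * (F (x2 t) j 0 - F (x1 t) j 0).
pose C := (\sum_j u 0 j) * input_gain.
have U0 : 0 <= \sum_j u 0 j by apply: sumr_ge0 => j _; exact: ltW.
have G0 := input_gain_ge0.
have C0 : 0 <= C by rewrite mulr_ge0.
have cz j : {within `[0, T], continuous (z j)}.
  move=> t; apply: cvgM; first exact: cvg_cst.
  by apply: cvgB; apply: within_continuous_coord.
have zdz j t : 0 < t < T -> is_derive t (1 : R) (z j) (dz j t).
  move=> tT; apply: is_deriveZ; apply: is_deriveB.
    by apply: is_derive_coord; exact: dx2.
  by apply: is_derive_coord; exact: dx1.
have dz_ge j t v : 0 < t < T -> v <= 0 -> (forall k, v <= z k t) ->
    C * v - d * z j t <= dz j t.
  move=> tT v0 vz.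
  have -> : dz j t = - d * z j t + u 0 j *
      (S ((-1) ^+ b j * input (x2 t) j) - S ((-1) ^+ b j * input (x1 t) j)).
    by rewrite -!saturating_signr /dz /z !opinion_fieldE; ring.
  rewrite mulNr [leRHS]addrC lerD2r.
  have uG : C * v <= u 0 j * (input_gain * v).
    rewrite /C -mulrA ler_wnM2r ?sum_u_ge//.
    by rewrite mulr_ge0_le0.
  apply: le_trans uG _; rewrite ler_pM2l//.
  apply: (saturating_incr_ge _ _ hS); first by rewrite mulr_ge0_le0.
  apply: le_trans (ler_wnM2r v0 (input_gain_ge j)) _.
  have -> : (-1) ^+ b j * input (x2 t) j - (-1) ^+ b j * input (x1 t) j =
      alpha * z j t +
      gamma * \sum_k ((-1) ^+ b j * A j k * (-1) ^+ b k) * z k t.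
    rewrite -mulrBr /input opprD addrACA -!mulrBr -sumrB mulrDr.
    rewrite mulrCA; congr (_ + _); rewrite mulrCA; congr (_ * _).
    rewrite mulr_sumr; apply: eq_bigr => k _.
    by rewrite /z [RHS]mulrA -(mulrA _ _ ((-1) ^+ b k)) -expr2 sqrr_sign; ring.
  rewrite mulrDl lerD//; first by rewrite ler_wpM2l.
  rewrite -mulrA ler_pM2l// mulr_suml; apply: ler_sum => k _.
  have -> : `|A j k| = (-1) ^+ b j * A j k * (-1) ^+ b k.
    by rewrite -[RHS](ger0_norm (Ab j k)) !normrM !normr_sign mulr1 mul1r.
  by rewrite ler_wpM2l.
have z0 j : 0 <= z j 0 by have := x12 j; rewrite !mxE.
have := nonneg_of_quasipositive _ _ z dz T d C T0 (ltW d0) C0 cz zdz dz_ge z0 i.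
by rewrite /z !mxE.
Qed.

Lemma monotone_adjacency (b : 'I_m -> bool) (i k : 'I_m) :
  type_K_monotone (orthant b) F -> i != k ->
  0 <= (-1) ^+ b i * A i k * (-1) ^+ b k.
Proof.
move=> mono ik; rewrite leNgt; apply/negP => neg.
(* theta_k e_k, where theta_j = (-1) ^+ b j *)
pose x0 : 'cV[R]_m := \col_j ((j == k)%:R * (-1) ^+ b k).
have [T [x [T0 xx0 sol]]] :=
  lipschitz_ode_local_solution _ _ F _ opinion_field_lipschitz x0.
have sol0 s : solution F s (cst 0).
  split=> [|t _]; first by move=> t; exact: cvg_cst.
  suff -> : F (cst 0 t) = 0 by exact: is_derive_cst.
  apply/colP => j; rewrite opinion_fieldE /input !mxE.
  rewrite big1 => [|l _]; last by rewrite mxE mulr0.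
  by rewrite !mulr0 addr0 (saturating_0 hS) mulr0 addr0.
have [cx dx] := sol.
pose z t := (-1) ^+ b i * x t i 0.
pose dz t := (-1) ^+ b i * F (x t) i 0.
have cz : {within `[0, T], continuous z}.
  by move=> t; apply: cvgM; [exact: cvg_cst|exact: within_continuous_coord].
have cdz : {within `[0, T], continuous dz}.
  move=> t; apply: cvgM; first exact: cvg_cst.
  apply: within_continuous_coord => {}t.
  apply: (@continuous_comp (subspace _) _ _ x F); first exact: cx.
  exact: (lipschitz_continuous _ _ _ _ opinion_field_lipschitz).
have zdz t : 0 < t < T -> is_derive t (1 : R) z (dz t).
  by move=> tT; apply: is_deriveZ; apply: is_derive_coord; exact: dx.
have z0 : z 0 = 0 by rewrite /z xx0 mxE (negPf ik) mul0r mulr0.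
have dz0 : dz 0 < 0.
  have inp : input x0 i = gamma * (A i k * (-1) ^+ b k).
    rewrite /input mxE (negPf ik) mul0r mulr0 add0r (bigD1 k)//= big1 ?addr0.
      by rewrite mxE eqxx mul1r.
    by move=> l /negPf lk; rewrite mxE lk mul0r mulr0.
  rewrite /dz opinion_fieldE xx0 inp mxE (negPf ik) mul0r mulr0 add0r.
  rewrite mulrCA pmulr_rlt0// saturating_signr mulrCA (mulrA _ (A i k)).
  rewrite -oppr_gt0 -(saturating_odd hS).
  by apply: saturating_gt0 => //; rewrite oppr_gt0 pmulr_rlt0.
have [s s0T dz_neg] : exists2 s, 0 < s <= T & forall t, 0 < t < s -> dz t < 0.
  have /subspace_continuousP/(_ 0) := cdz.
  rewrite /= in_itv /= lexx (ltW T0) => /(_ isT)/cvgrPdist_lt/(_ (- dz 0)).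
  rewrite oppr_gt0 => /(_ dz0)/nbhs_ballP[e /= e0 h].
  exists (Num.min e T); first by rewrite lt_min e0 T0 ge_min lexx orbT.
  move=> t; rewrite lt_min => /and3P[t0 te tT].
  have : `|dz 0 - dz t| < - dz 0.
    apply: h; last by rewrite /= in_itv /= !ltW.
    by rewrite -ball_normE /= sub0r normrN gtr0_norm.
  by rewrite ltr_norml => /andP[? ?]; lra.
have [s0 sT] := andP s0T.
have cz' : {within `[0, s], continuous z}.
  by apply: continuous_subspaceW cz; apply: subset_itv; rewrite ?bnd_simp.
have zdz' t : t \in `]0, s[ -> is_derive t (1 : R) z (dz t).
  by rewrite in_itv /= => /andP[t0 ts]; apply: zdz; rewrite t0 (lt_le_trans ts).
have [c] := MVT s0 zdz' cz'.
rewrite in_itv /= z0 !subr0 => c0s zs.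
have : 0 <= z s.
  have := mono (cst 0) x s s0 (sol0 s) (solution_subitv _ _ _ _ _ _ sT sol).
  rewrite /cone_le /cst !subr0 => /(_ _ i); rewrite /orthant /=; apply => j.
  rewrite xx0 mxE mulrCA; case: eqVneq => [->|_]; last by rewrite mul0r.
  by rewrite -expr2 sqrr_sign mulr1.
by rewrite zs leNgt nmulr_rlt0 ?s0// dz_neg.
Qed.

End opinion.

(** * Signed graphs *)

Lemma switched_signE (R : realType) (N : nat) (W : {set 'I_N})
    (G : signed_graph N) (i k : 'I_N) :
  (switched_sign W G i k)%:~R =
    (-1) ^+ (i \in W) * (sign G i k)%:~R * (-1) ^+ (k \in W) :> R.
Proof.
have thetaE j : (theta W j)%:~R = (-1) ^+ (j \in W) :> R.
  by rewrite /theta; case: (j \in W).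
by rewrite /switched_sign !intrM !thetaE.
Qed.

Theorem lemmaV1 (R : realType) (N : nat) (G : signed_graph N)
    (d alpha gamma : R) (u : 'rV[R]_N) (S : R -> R)
    (hd : 0 < d) (halpha : 0 <= alpha) (hgamma : 0 < gamma)
    (hu : forall i, 0 < u 0 i) (hS : saturating S) :
  (exists K : set 'cV[R]_N, is_orthant K /\
     type_K_monotone K (opinion_field (adjacency R G) d alpha gamma u S))
  <-> structurally_balanced G.
Proof.
split=> [[_ [[b ->] mono]]|[W [_ GW]]].
- exists [set i | b i]%SET; split=> //= i k ik.
  have neq_ik : i != k.
    by apply/eqP => eik; move: ik; rewrite eik (edge_irr G).
  have := monotone_adjacency _ _ _ _ _ _ _ _ hd halpha hgamma hu hS _ i k mono neq_ik.
  rewrite mxE ik; have := switched_signE R N [set i | b i]%SET G i k.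
  rewrite !inE => <-.
  by have [->|->] := switched_sign_edge [set i | b i]%SET ik; rewrite ?ler0z.
- exists (orthant (fun i => i \in W)); split; first by exists (fun i => i \in W).
  apply: opinion_field_monotone => // i k.
  rewrite mxE; case: ifP => [ik|_]; last by rewrite mulr0 mul0r.
  by rewrite -switched_signE; have /= -> := GW i k ik.
Qed.
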